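(* Let $m,n\in\mathbb{N}$ and $d=m+n$. For any $A\in M_{m,n}(\mathbb{R})$ and any pair of norms $\rho,\sigma$ on $\mathbb{R}^m$ and $\mathbb{R}^n$ respectively, we have $$\lambda_{\rho,\sigma}(A)=\liminf_{t\to\infty}\delta_\eta(g_t x_A)^d,$$ where $\eta$ is the norm on $\mathbb{R}^d=\mathbb{R}^m\times\mathbb{R}^n$ given by $\eta\big((\mathbf{y},\mathbf{z})\big)=\max\big(\rho(\mathbf{y}),\sigma(\mathbf{z})\big)$.
   Context: $M_{m,n}(\mathbb{R})$ is the space of real $m\times n$ matrices. The Lagrange constant of $A$ is $$\lambda_{\rho,\sigma}(A):=\liminf_{\mathbf{q}\to\infty,\ \mathbf{q}\in\mathbb{Z}^n}\ \sigma(\mathbf{q})^n\min_{\mathbf{p}\in\mathbb{Z}^m}\rho(A\mathbf{q}-\mathbf{p})^m .$$ $X_d=\mathrm{SL}_d(\mathbb{R})/\mathrm{SL}_d(\mathbb{Z})$ is identified with the space of unimodular lattices in $\mathbb{R}^d$ via $g\,\mathrm{SL}_d(\mathbb{Z})\mapsto g\mathbb{Z}^d$. For a norm $\eta$ on $\mathbb{R}^d$ and $x\in X_d$, $\delta_\eta(x):=\inf_{\mathbf{v}\in x\setminus\{0\}}\eta(\mathbf{v})$. For $t\in\mathbb{R}$, $$g_t:=\begin{pmatrix} e^{t/m}I_m&0\\0&e^{-t/n}I_n\end{pmatrix},$$ and $x_A:=u_A\mathbb{Z}^d\in X_d$, where $u_A:=\begin{pmatrix} I_m&A\\0&I_n\end{pmatrix}$.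 *)

(* Defs.v *)
From HB Require Import structures.
From mathcomp Require Import all_boot all_order all_algebra.
From mathcomp Require Import zify.
From mathcomp Require Import all_classical all_reals all_analysis.
Set Implicit Arguments.
Unset Strict Implicit.
Unset Printing Implicit Defensive.
Import Order.TTheory GRing.Theory Num.Theory.
Import numFieldNormedType.Exports.
Local Open Scope classical_set_scope.
Local Open Scope ring_scope.

(* The canonical norm that the library puts on 'cV[R]_k is the sup norm, so an
   arbitrary norm is a function satisfying the axioms. *)
Record is_norm (R : realType) (k : nat) (f : 'cV[R]_k -> R) : Prop := IsNorm {
  is_norm_ge0 : forall x, 0 <= f x ;
  is_norm_eq0 : forall x, f x = 0 -> x = 0 ;
  is_normZ : forall (a : R) x, f (a *: x) = `|a| * f x ;
  is_normD : forall x y, f (x + y) <= f x + f y }.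

Definition Zvec (R : realType) (k : nat) : set 'cV[R]_k :=
  range (map_mx (intr : int -> R)).
Arguments Zvec : clear implicits.

(* The filter "q -> oo" on R^n; all norms give the same filter, here it is
   given by the sup norm. *)
Definition vec_infty (R : realType) (n : nat) : set_system 'cV[R]_n :=
  filter_from [set: R] (fun M => [set q : 'cV[R]_n | M < `|q|]).
Arguments vec_infty : clear implicits.

(* min_(p in Z^m) rho (A q - p) ^ m; the infimum is attained, see
   [min_dist_attained]. *)
Definition min_dist (R : realType) (m n : nat) (rho : 'cV[R]_m -> R)
    (A : 'M[R]_(m, n)) (q : 'cV[R]_n) : R :=
  inf [set rho (A *m q - p) ^+ m | p in Zvec R m].

Definition lagrange_constant (R : realType) (m n : nat)
    (rho : 'cV[R]_m -> R) (sigma : 'cV[R]_n -> R) (A : 'M[R]_(m, n)) : \bar R :=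
  limf_einf (fun q : 'cV[R]_n => (sigma q ^+ n * min_dist rho A q)%:E)
    (within (Zvec R n) (vec_infty R n)).

(* A point g SL_d(Z) of X_d = SL_d(R)/SL_d(Z) is identified with the lattice
   g Z^d, a set of vectors; SL_d(R) acts by direct image. *)
Definition lattice_of (R : realType) (d : nat) (g : 'M[R]_d) : set 'cV[R]_d :=
  [set g *m p | p in Zvec R d].

Definition lattice_act (R : realType) (d : nat) (g : 'M[R]_d) (x : set 'cV[R]_d) :
    set 'cV[R]_d :=
  [set g *m v | v in x].

Definition unimodular_lattice (R : realType) (d : nat) (x : set 'cV[R]_d) : Prop :=
  exists2 g : 'M[R]_d, \det g = 1 & x = lattice_of g.

Definition delta_norm (R : realType) (d : nat) (eta : 'cV[R]_d -> R)
    (x : set 'cV[R]_d) : R :=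
  inf [set eta v | v in x `\ 0].

Definition gflow (R : realType) (m n : nat) (t : R) : 'M[R]_(m + n) :=
  block_mx (expR (t / m%:R))%:M 0 0 (expR (- t / n%:R))%:M.

Definition umat (R : realType) (m n : nat) (A : 'M[R]_(m, n)) : 'M[R]_(m + n) :=
  block_mx 1%:M A 0 1%:M.

Definition xlat (R : realType) (m n : nat) (A : 'M[R]_(m, n)) : set 'cV[R]_(m + n) :=
  lattice_of (umat A).

Definition max_norm (R : realType) (m n : nat)
    (rho : 'cV[R]_m -> R) (sigma : 'cV[R]_n -> R) : 'cV[R]_(m + n) -> R :=
  fun v => Num.max (rho (usubmx v)) (sigma (dsubmx v)).

Lemma xlat_unimodular (R : realType) (m n : nat) (A : 'M[R]_(m, n)) :
  unimodular_lattice (xlat A).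
Proof. by exists (umat A) => //; rewrite det_ublock !det1 mulr1. Qed.

Lemma det_gflow (R : realType) (m n : nat) (t : R) :
  (0 < m)%N -> (0 < n)%N -> \det (gflow m n t) = 1.
Proof.
move=> m0 n0; rewrite det_ublock !det_scalar -!expRM_natl.
rewrite ![_%:R * _]mulrC !divfK ?pnatr_eq0 -?lt0n //.
by rewrite -expRD subrr expR0.
Qed.

Lemma lattice_act_unimodular (R : realType) (d : nat) (g : 'M[R]_d) (x : set 'cV[R]_d) :
  \det g = 1 -> unimodular_lattice x -> unimodular_lattice (lattice_act g x).
Proof.
move=> g1 [h h1 ->]; exists (g *m h); first by rewrite det_mulmx g1 h1 mulr1.
rewrite /lattice_act /lattice_of image_comp; apply: eq_imagel => p _ /=.
by rewrite mulmxA.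
Qed.

Lemma max_norm_is_norm (R : realType) (m n : nat)
    (rho : 'cV[R]_m -> R) (sigma : 'cV[R]_n -> R) :
  is_norm rho -> is_norm sigma -> is_norm (max_norm rho sigma).
Proof.
move=> [r0 r1 rZ rD] [s0 s1 sZ sD]; rewrite /max_norm; split.
- by move=> x; rewrite le_max r0.
- move=> x h; rewrite -[x]vsubmxK.
  have hr : rho (usubmx x) <= 0 by rewrite -h le_max lexx.
  have hs : sigma (dsubmx x) <= 0 by rewrite -h le_max lexx orbT.
  rewrite (r1 (usubmx x)); last by apply/le_anti; rewrite hr r0.
  rewrite (s1 (dsubmx x)); last by apply/le_anti; rewrite hs s0.
  by rewrite col_mx0.
- by move=> a x; rewrite !linearZ /= rZ sZ maxr_pMr.
- move=> x y; rewrite !linearD /= ge_max; apply/andP; split.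
  + by apply: (le_trans (rD _ _)); rewrite lerD // le_max lexx.
  + by apply: (le_trans (sD _ _)); rewrite lerD // le_max lexx orbT.
Qed.

Section min_dist_attained.
Variables (R : realType) (k : nat) (f : 'cV[R]_k -> R).
Hypothesis fN : is_norm f.

Let f0 : f 0 = 0.
Proof. by rewrite -(scale0r 0) (is_normZ fN) normr0 mul0r. Qed.

Let fopp x : f (- x) = f x.
Proof. by rewrite -scaleN1r (is_normZ fN) normrN normr1 mul1r. Qed.

Lemma is_norm_upper : exists2 C, 0 <= C & forall x, f x <= C * `|x|.
Proof.
exists (\sum_i f (delta_mx i 0)); first by apply: sumr_ge0 => i _; apply: is_norm_ge0.
move=> x; rewrite {1}(matrix_sum_delta x).
have -> : \sum_i \sum_(j < 1) x i j *: delta_mx i j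
    = \sum_i x i 0 *: (delta_mx i 0 : 'cV[R]_k).
  by apply: eq_bigr => i _; rewrite big_ord1.
rewrite mulr_suml.
elim/big_ind2 : _ => [|x1 x2 y1 y2 h1 h2|i _].
- by rewrite f0.
- by apply: (le_trans (is_normD fN _ _)); apply: lerD.
- rewrite (is_normZ fN) mulrC ler_wpM2l ?(is_norm_ge0 fN) //.
  rewrite [leRHS]/Num.norm /= mx_normrE.
  by apply/bigmax_geP; right => /=; exists (i, 0).
Qed.

Lemma is_norm_lower : exists2 c, 0 < c & forall x, c * `|x| <= f x.
Proof.
have nT (x : 'rV[R]_k) : `|x^T| = `|x|.
  have aux a b (y : 'M[R]_(a, b)) : `|y^T| <= `|y|.
    rewrite ![`|_|]/Num.norm /= [leLHS]mx_normrE; apply/bigmax_leP; split.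
      by rewrite mx_normrE; elim/big_ind : _ => // u v u0 v0; rewrite le_max u0.
    move=> [i j] _ /=; rewrite mxE mx_normrE; apply/bigmax_geP; right.
    by exists (j, i).
  by apply/le_anti; rewrite aux -{1}(trmxK x) aux.
pose g (x : 'rV[R]_k) := f x^T.
have [C C0 fC] := is_norm_upper.
have gcont : continuous g.
  move=> x; apply/(@cvgrPdist_le R R _ (nbhs x) (nbhs_filter x)) => e e0.
  have C1 : 0 < C + 1 by rewrite ltr_wpDl.
  near=> y.
  have h (u v : 'cV[R]_k) : f u - f v <= f (u - v).
    by rewrite lerBlDr -{1}(subrK v u) is_normD.
  have : `|g x - g y| <= f (x - y)^T.
    rewrite /g linearB /= ler_norml h andbT lerNl opprB.
    by rewrite -(fopp (_ - _)) opprB h.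
  move=> /le_trans; apply.
  apply: (le_trans (fC _)); rewrite nT.
  apply: (@le_trans _ _ ((C + 1) * `|x - y|)).
    by rewrite ler_wpM2r // lerDl.
  rewrite -ler_pdivlMl // mulrC.
  near: y; apply: (@cvgr_dist_le _ _ _ (nbhs x) _ id x cvg_id).
  exact: divr_gt0.
pose S := [set x : 'rV[R]_k | `|x| = 1].
have [S0|S0] := pselect (S !=set0); last first.
  exists 1 => // x; rewrite mul1r.
  have [->|x0] := eqVneq x 0; first by rewrite normr0 (is_norm_ge0 fN).
  exfalso; apply: S0; exists ((`|x|^-1 *: x)^T); rewrite /S /=.
  rewrite -nT trmxK normrZ ger0_norm ?invr_ge0 // mulVf //.
  by rewrite normr_eq0.
have Sc : compact S.
  apply: bounded_closed_compact.
    by exists 1; split => // M M1 x /= ->; exact: ltW.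
  have -> : S = (@Num.norm R 'rV[R]_k) @^-1` [set 1] by [].
  apply: preimage_closed => [? _|]; first exact: norm_continuous.
  exact: closed_eq.
have [c cS cmin] := EVT_min_rV S0 Sc (continuous_subspaceT gcont).
move: cS; rewrite inE /S /= => c1.
exists (g c).
  rewrite lt_neqAle (is_norm_ge0 fN) andbT eq_sym; apply/eqP => /(is_norm_eq0 fN).
  by move=> h; move: c1; rewrite -nT h normr0 => /esym/eqP; rewrite oner_eq0.
move=> x; have [->|x0] := eqVneq x 0; first by rewrite normr0 mulr0 f0.
have x1 : 0 < `|x| by rewrite normr_gt0.
have := cmin (`|x|^-1 *: x)^T.
rewrite /g trmxK (is_normZ fN) (ger0_norm (ltW _)) ?invr_gt0 //.
rewrite ler_pdivlMl // mulrC; apply.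
rewrite inE /S /= -nT trmxK normrZ ger0_norm ?invr_ge0 // mulVf //.
by rewrite gt_eqF.
Unshelve. all: by end_near. Qed.

Lemma finite_Zvec_ball (M : R) : finite_set [set p | Zvec R k p /\ `|p| <= M].
Proof.
pose N := Num.truncn `|M|.
pose h (t : {ffun 'I_k -> 'I_(N.*2.+1)}) : 'cV[R]_k :=
  \col_i ((t i)%:R - N%:R).
apply: (@sub_finite_set _ _ (range h)); last exact: finite_image.
move=> _ /= [[z _ <-]] zM.
have zi i : (`|z i ord0| <= N)%N.
  rewrite /N truncn_ge_nat //.
  apply: (@le_trans _ _ M); last exact: ler_norm.
  apply: le_trans zM.
  rewrite [leRHS]/Num.norm /= mx_normrE; apply/bigmax_geP; right.
  by exists (i, ord0) => //=; rewrite mxE -intr_norm natr_absz.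
have zN i : exists n : 'I_(N.*2.+1), (n%:Z - N%:Z == z i ord0)%R.
  have hi := zi i.
  have hn : (`|(z i ord0 + N%:Z)%R| < N.*2.+1)%N by lia.
  by exists (Ordinal hn) => /=; lia.
exists [ffun i => xchoose (zN i)] => //.
apply/colP => i; rewrite /h !mxE ffunE.
by have := xchooseP (zN i); move: (xchoose _) => u /eqP <-; rewrite intrB.
Qed.

Lemma seq_min (T : eqType) (h : T -> R) (s : seq T) (x0 : T) : x0 \in s ->
  exists2 x, x \in s & forall y, y \in s -> h x <= h y.
Proof.
elim: s x0 => // a [|b s] IH x0 _.
  by exists a; rewrite ?inE // => y; rewrite inE => /eqP ->.
have [x xs xmin] := IH b (mem_head _ _).
have [ax|xa] := leP (h a) (h x).
- exists a; rewrite ?mem_head // => y; rewrite inE => /predU1P[->//|ys].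
  by apply: (le_trans ax); exact: xmin.
- exists x; first by rewrite inE xs orbT.
  by move=> y; rewrite inE => /predU1P[->|ys]; [exact: ltW|exact: xmin].
Qed.

Lemma is_norm_Zvec_min (y : 'cV[R]_k) :
  exists2 p, Zvec R k p & forall p', Zvec R k p' -> f (y - p) <= f (y - p').
Proof.
have [c c0 fc] := is_norm_lower.
pose B := [set p | Zvec R k p /\ `|p| <= `|y| + f y / c].
have Z0 : Zvec R k 0 by exists 0 => //; rewrite map_mx0.
have inB p : Zvec R k p -> f (y - p) <= f y -> B p.
  move=> Zp fp; split => //.
  have h : `|y - p| <= f y / c.
    by rewrite ler_pdivlMr // mulrC (le_trans (fc _)).
  by rewrite -[p](subKr y) (le_trans (ler_normB _ _)) // lerD2l.
have /finite_seqP[s sB] : finite_set B by exact: finite_Zvec_ball.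
have memB p : (p \in s) = (p \in B) by rewrite sB; apply/idP/idP; rewrite inE.
have s0 : 0 \in s by rewrite memB inE; apply: inB => //; rewrite subr0.
have [p ps pmin] := seq_min (fun p => f (y - p)) s0.
exists p; first by move: ps; rewrite memB inE => -[].
move=> p' Zp'; have [h|h] := leP (f (y - p')) (f y).
  by apply: pmin; rewrite memB inE; exact: inB.
by apply: le_trans (ltW h); rewrite -[leRHS]subr0; move: (pmin _ s0); rewrite !subr0.
Qed.

End min_dist_attained.

Lemma min_dist_attained (R : realType) (m n : nat) (rho : 'cV[R]_m -> R)
    (A : 'M[R]_(m, n)) (q : 'cV[R]_n) : is_norm rho ->
  exists2 p, Zvec R m p & min_dist rho A q = rho (A *m q - p) ^+ m.
Proof.
move=> rhoN; have [p Zp pmin] := is_norm_Zvec_min rhoN (A *m q).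
exists p => //; apply/le_anti/andP; split.
- apply: ge_inf; last by exists p.
  by exists 0 => _ [p' _ <-]; rewrite exprn_ge0 ?is_norm_ge0.
- apply: lb_le_inf; first by exists (rho (A *m q - p) ^+ m); exists p.
  by move=> _ [p' Zp' <-]; rewrite lerXn2r ?nnegrE ?is_norm_ge0 //; exact: pmin.
Qed.

(* Main.v *)
(** A lattice vector of [g_t x_A] is [(e^(t/m) (A q - p), e^(-t/n) q)] with [p], [q] integral,
and [(e^(t/m) rho (A q - p)) ^ m * (e^(-t/n) sigma q) ^ n] does not depend on [t].  The maximum
of the two factors, raised to the power [m + n], dominates this product, with equality at the
time [t] at which the factors agree.  This time tends to infinity with [q], because [A q] stays
at bounded distance from the integral vectors; conversely, for large [t] the vectors with bounded [q]
are not short, unless [A q = p] for some [q != 0], in which case both sides vanish. *)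
Require Import Defs.
From mathcomp Require Import all_boot all_order all_algebra.
From mathcomp Require Import all_classical all_reals all_analysis.
Import Order.TTheory GRing.Theory Num.Theory.
Import numFieldNormedType.Exports.
Local Open Scope classical_set_scope.
Local Open Scope ring_scope.

(** A lower limit is the supremum of the infima over the sets of the filter, so each such infimum
    for [f] only has to be matched by one set of [G]. *)
Lemma limf_einf_le {R : realType} {X Y : topologicalType} {f : X -> \bar R} {g : Y -> \bar R}
    {F : set (set X)} {G : set (set Y)} :
  (forall V, F V -> exists2 W, G W & forall y, W y -> (ereal_inf (f @` V) <= g y)%E) ->
  (limf_einf f F <= limf_einf g G)%E.
Proof.
move=> h; rewrite !limf_einfE; apply: ge_ereal_sup => _ [V FV <-].
have [W GW hW] := h V FV.
apply: le_ereal_sup_tmp; exists (ereal_inf (g @` W)); first by exists W.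
by apply: le_ereal_inf_tmp => _ [y Wy <-]; exact: hW.
Qed.

(** * Roots and integral vectors *)

Lemma exists_root_ge0 {R : realType} {d : nat} {x : R} : (0 < d)%N -> 0 <= x ->
  exists2 s, 0 <= s & s ^+ d = x.
Proof.
move=> d0 x0; exists (x `^ d%:R^-1); first exact: powR_ge0.
by rewrite -powR_mulrn ?powR_ge0 // -powRrM mulVf ?powRr1 // pnatr_eq0 -lt0n.
Qed.

Lemma ler_mxnorm_entry {R : realType} {k : nat} (x : 'cV[R]_k) i : `|x i ord0| <= `|x|.
Proof.
rewrite [leRHS]/Num.norm /= mx_normrE; apply/bigmax_geP; right.
by exists (i, ord0).
Qed.

Lemma Zvec_norm_ge1 {R : realType} {k : nat} {p : 'cV[R]_k} : Zvec R k p -> p != 0 -> 1 <= `|p|.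
Proof.
move=> [z _ <-] z0.
have [i zi] : exists i, z i ord0 != 0.
  apply/existsP; apply: contraR z0 => /existsPn h.
  apply/eqP/colP => i; rewrite !mxE.
  by have := h i; rewrite negbK => /eqP ->.
apply: le_trans (ler_mxnorm_entry _ i).
by rewrite mxE -intr_norm ler1z -gtz0_ge1 normr_gt0.
Qed.

Lemma Zvec_natmul {R : realType} {k : nat} {p : 'cV[R]_k} (N : nat) : Zvec R k p ->
  Zvec R k (N%:R *: p).
Proof.
move=> [z _ <-]; exists (N%:R *: z) => //.
by apply/colP => i; rewrite !mxE rmorphM /= rmorph_nat.
Qed.

Lemma Zvec_near {R : realType} {k : nat} (y : 'cV[R]_k) :
  exists2 p, Zvec R k p & `|y - p| <= 1.
Proof.
exists (map_mx intr (\col_i Num.floor (y i ord0))); first by exists (\col_i Num.floor (y i ord0)).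
rewrite [leLHS]/Num.norm /= mx_normrE; apply/bigmax_leP; split => // -[i j] _ /=.
rewrite !mxE (ord1 j) ger0_norm ?subr_ge0 ?floor_le //.
have /andP[_] := floor_itv (y i ord0).
by rewrite lerBlDl intrD => /ltW; rewrite addrC.
Qed.

(** * Vectors of the lattice [g_t x_A] and their norms *)

Section dani_correspondence.
Context {R : realType} {m n : nat} (A : 'M[R]_(m, n)).
Context {rho : 'cV[R]_m -> R} {sigma : 'cV[R]_n -> R}.
Hypotheses (hm : (0 < m)%N) (hn : (0 < n)%N).
Hypotheses (hrho : is_norm rho) (hsigma : is_norm sigma).

Let height t (p : 'cV[R]_m) (q : 'cV[R]_n) :=
  Num.max (expR (t / m%:R) * rho (A *m q - p)) (expR (- t / n%:R) * sigma q).

Let delta t := delta_norm (max_norm rho sigma) (lattice_act (gflow m n t) (xlat A)).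

Let gflow_umatE t (p : 'cV[R]_m) (q : 'cV[R]_n) : gflow m n t *m (umat A *m col_mx (- p) q) =
  col_mx (expR (t / m%:R) *: (A *m q - p)) (expR (- t / n%:R) *: q).
Proof.
rewrite /gflow /umat !mul_block_col !mul0mx !mul1mx add0r add0r addr0.
by rewrite !mul_scalar_mx addrC.
Qed.

Let max_norm_gflow t (p : 'cV[R]_m) (q : 'cV[R]_n) : max_norm rho sigma (gflow m n t *m (umat A *m col_mx (- p) q)) =
  height t p q.
Proof.
rewrite gflow_umatE /max_norm col_mxKu col_mxKd (is_normZ hrho) (is_normZ hsigma).
by rewrite !ger0_norm ?expR_ge0.
Qed.

Let height_in_image t p q : Zvec R m p -> Zvec R n q -> q != 0 ->
  [set max_norm rho sigma v | v in lattice_act (gflow m n t) (xlat A) `\ 0] (height t p q).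
Proof.
move=> [p' _ <-] [q' _ <-] q0.
exists (gflow m n t *m (umat A *m col_mx (- map_mx intr p') (map_mx intr q')));
  last exact: max_norm_gflow.
split => /=.
  exists (umat A *m col_mx (- map_mx intr p') (map_mx intr q')) => //.
  exists (col_mx (- map_mx intr p') (map_mx intr q')) => //.
  by exists (col_mx (- p') q') => //; rewrite map_col_mx map_mxN.
rewrite gflow_umatE => /(congr1 dsubmx)/eqP; rewrite col_mxKd linear0 scaler_eq0.
by rewrite gt_eqF ?expR_gt0 // (negbTE q0).
Qed.

Let delta_le t p q : Zvec R m p -> Zvec R n q -> q != 0 -> delta t <= height t p q.
Proof.
move=> Zp Zq q0; apply: ge_inf; last exact: height_in_image.
by exists 0 => _ [v _ <-]; exact: is_norm_ge0 (max_norm_is_norm hrho hsigma) _.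
Qed.

Let delta_ge t r : (forall p q, Zvec R m p -> Zvec R n q -> ~ (p = 0 /\ q = 0) ->
  r <= height t p q) -> r <= delta t.
Proof.
move=> hr; apply: lb_le_inf.
  (* [inf] is a greatest lower bound only on a nonempty set; the all-ones [q] is nonzero because
     [0 < n]. *)
  exists (height t 0 (const_mx 1)); apply: height_in_image.
  - by exists 0 => //; rewrite map_mx0.
  - by exists (const_mx 1) => //; apply/colP => i; rewrite !mxE.
  - apply/eqP => /colP /(_ (Ordinal hn)); rewrite !mxE => /eqP.
    by rewrite oner_eq0.
move=> _ [_ [[_ [_ [z _ <-] <-] <-] /= v0] <-].
pose p : 'cV[R]_m := map_mx intr (- usubmx z); pose q : 'cV[R]_n := map_mx intr (dsubmx z).
have zE : map_mx intr z = col_mx (- p) q :> 'cV[R]_(m + n).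
  by rewrite /p /q map_mxN opprK -map_col_mx vsubmxK.
rewrite zE max_norm_gflow; apply: hr.
- by exists (- usubmx z).
- by exists (dsubmx z).
- by move=> [p0 q0]; apply: v0; rewrite zE p0 q0 oppr0 col_mx0 !mulmx0.
Qed.

Lemma delta_ge0 t : 0 <= delta t.
Proof.
by apply: delta_ge => p q _ _ _; rewrite le_max mulr_ge0 // ?expR_ge0 // is_norm_ge0.
Qed.

(** * Comparison of [delta] with the terms of the Lagrange constant *)

Let expR_m (t : R) : expR (t / m%:R) ^+ m = expR t.
Proof. by rewrite -expRM_natr divfK // pnatr_eq0 -lt0n. Qed.

Let expR_n (t : R) : expR (- t / n%:R) ^+ n = expR (- t).
Proof. by rewrite -expRM_natr divfK // pnatr_eq0 -lt0n. Qed.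

Let expR_mn (t a b : R) : (expR (t / m%:R) * a) ^+ m * (expR (- t / n%:R) * b) ^+ n =
  b ^+ n * a ^+ m.
Proof.
by rewrite !exprMn expR_m expR_n mulrACA expRN mulfV ?gt_eqF ?expR_gt0 // mul1r mulrC.
Qed.

Let min_dist_ge0 q : 0 <= min_dist rho A q.
Proof.
have [p _ ->] := min_dist_attained A q hrho.
by rewrite exprn_ge0 // is_norm_ge0.
Qed.

Let min_dist_le q p : Zvec R m p -> min_dist rho A q <= rho (A *m q - p) ^+ m.
Proof.
move=> Zp; apply: ge_inf; last by exists p.
by exists 0 => _ [p' _ <-]; rewrite exprn_ge0 // is_norm_ge0.
Qed.

Let height_ge t p q : Zvec R m p ->
  sigma q ^+ n * min_dist rho A q <= height t p q ^+ (m + n).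
Proof.
move=> Zp; apply: (@le_trans _ _ (sigma q ^+ n * rho (A *m q - p) ^+ m)).
  by rewrite ler_wpM2l ?min_dist_le // exprn_ge0 // is_norm_ge0.
rewrite -(expR_mn t) exprD.
have a0 : 0 <= expR (t / m%:R) * rho (A *m q - p) by rewrite mulr_ge0 ?expR_ge0 ?is_norm_ge0.
have b0 : 0 <= expR (- t / n%:R) * sigma q by rewrite mulr_ge0 ?expR_ge0 ?is_norm_ge0.
by rewrite ler_pM ?exprn_ge0 // lerXn2r ?nnegrE // le_max ?a0 ?lexx ?b0 ?orbT.
Qed.

(** Only finitely many integral [q] lie in the ball, and for each nonzero one the minimum over [p]
    is attained, hence positive. For [q = 0] the vector [p] is nonzero and [rho] is at least [c]
    there. *)
Let dist_lower (M : R) :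
  (forall p q, Zvec R m p -> Zvec R n q -> q != 0 -> rho (A *m q - p) != 0) ->
  exists2 mu, 0 < mu & forall p q, Zvec R m p -> Zvec R n q -> ~ (p = 0 /\ q = 0) ->
    `|q| <= M -> mu <= rho (A *m q - p).
Proof.
move=> irr; have [c c0 hc] := is_norm_lower hrho.
have /finite_seqP[s hs] := finite_Zvec_ball n M.
have mems q : Zvec R n q -> `|q| <= M -> q \in s.
  by move=> Zq qM; have : [set` s] q by rewrite -hs.
have [mu mu0 hmu] : exists2 mu, 0 < mu & forall p q, Zvec R m p -> Zvec R n q ->
    q != 0 -> q \in s -> mu <= rho (A *m q - p).
  elim: s {hs mems} => [|a s [mu mu0 IH]]; first by exists 1.
  have [[Za a0]|Na] := pselect (Zvec R n a /\ a != 0); last first.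
    exists mu => // p q Zp Zq q0; rewrite inE => /predU1P[qa|]; last exact: IH.
    by exfalso; apply: Na; rewrite -qa.
  have [p0 Zp0 p0min] := is_norm_Zvec_min hrho (A *m a).
  exists (Num.min mu (rho (A *m a - p0))).
    by rewrite lt_min mu0 lt_neqAle eq_sym irr // is_norm_ge0.
  move=> p q Zp Zq q0; rewrite inE => /predU1P[->|qs]; rewrite ge_min.
    by rewrite p0min // orbT.
  by rewrite IH.
exists (Num.min mu c); first by rewrite lt_min mu0.
move=> p q Zp Zq pq0 qM; have [q0|q0] := eqVneq q 0; last first.
  by rewrite ge_min hmu // mems.
rewrite q0 mulmx0 sub0r ge_min; apply/orP; right; apply: le_trans (hc _).
rewrite normrN ler_peMr ?(ltW c0) // Zvec_norm_ge1 //.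
by apply/eqP => p0; apply: pq0.
Qed.

(** Vectors with [M < |q|] are controlled at every time by [height_ge]. For the others
    [rho (A q - p)] is at least a fixed [mu], and the expanding factor eventually makes the first
    component long. *)
Lemma delta_ge_eventually (r M : R) : 0 < r ->
  (forall q, Zvec R n q -> M < `|q| -> r <= sigma q ^+ n * min_dist rho A q) ->
  exists T, forall t, T < t -> r <= delta t ^+ (m + n).
Proof.
move=> r0 hr.
(* An exact solution [A q = p] would give the solutions [(N p, N q)], whose terms vanish beyond [M],
   against [0 < r]. *)
have irr p q : Zvec R m p -> Zvec R n q -> q != 0 -> rho (A *m q - p) != 0.
  move=> Zp Zq q0; apply/eqP => h.
  pose N := (Num.truncn `|M|).+1.
  have MN : M < `|N%:R *: q|.
    rewrite normrZ normr_nat; apply: (@lt_le_trans _ _ N%:R).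
      by rewrite (le_lt_trans (ler_norm M)) // truncnS_gt.
    by rewrite ler_peMr // Zvec_norm_ge1.
  have := hr _ (Zvec_natmul N Zq) MN; apply/negP; rewrite -ltNge.
  suff -> : min_dist rho A (N%:R *: q) = 0 by rewrite mulr0.
  apply/le_anti; rewrite min_dist_ge0 andbT.
  apply: le_trans (min_dist_le _ _ (Zvec_natmul N Zp)) _.
  by rewrite -scalemxAr -scalerBr (is_normZ hrho) h mulr0 expr0n eqn0Ngt hm.
have [mu mu0 hmu] := dist_lower M irr.
have [s s0 sr] : exists2 s, 0 <= s & s ^+ (m + n) = r.
  by apply: exists_root_ge0; [rewrite addn_gt0 hm | exact: ltW].
have s1 : 0 < s.
  rewrite lt_neqAle s0 andbT eq_sym; apply/eqP => sE.
  by move: r0; rewrite -sr sE expr0n addn_eq0 eqn0Ngt hm ltxx.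
(* This is the time at which [e^(t/m) mu] reaches [s], the root of [r] of order [m + n]. *)
exists (m%:R * ln (s / mu)) => t Tt; rewrite -sr lerXn2r ?nnegrE ?delta_ge0 //.
apply: delta_ge => p q Zp Zq pq0; have [qM|Mq] := leP `|q| M.
  rewrite le_max; apply/orP; left.
  apply: (@le_trans _ _ (expR (t / m%:R) * mu)); last by rewrite ler_pM2l ?expR_gt0 ?hmu.
  rewrite -ler_pdivrMr // -[s / mu]lnK ?posrE ?divr_gt0 // ler_expR.
  by rewrite ler_pdivlMr ?ltr0n // mulrC ltW.
rewrite -(@ler_pXn2r _ (m + n)) ?nnegrE ?addn_gt0 ?hm //; last first.
  by rewrite le_max mulr_ge0 // ?expR_ge0 // is_norm_ge0.
by rewrite sr (le_trans (hr _ Zq Mq)) // height_ge.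
Qed.

(** The vector given by [q] and its best [p] is tested at its balancing time. The slack [e] serves
    the case [A q = p], where the two factors never agree but the second one tends to 0. *)
Lemma delta_le_frequently (T : R) :
  exists M, forall q, Zvec R n q -> M < `|q| -> forall e, 0 < e ->
    exists2 t, T < t & delta t ^+ (m + n) <= sigma q ^+ n * min_dist rho A q + e.
Proof.
have [c c0 hc] := is_norm_lower hsigma.
have [C C0 hC] := is_norm_upper hrho.
pose k : R := m%:R^-1 + n%:R^-1.
have k0 : 0 < k by rewrite addr_gt0 // invr_gt0 ltr0n.
(* The 0 forces [q != 0]; the other bound gives [sigma q >= c |q| > C e^(T k)], which puts the
   balancing time after [T] once [rho (A q - p) <= C]. *)
exists (Num.max 0 (C * expR (T * k) / c)) => q Zq.
rewrite gt_max normr_gt0 => /andP[q0 qM] e e0.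
have sig0 : 0 < sigma q by apply: lt_le_trans (hc q); rewrite mulr_gt0 ?normr_gt0.
have [p Zp md] := min_dist_attained A q hrho.
have [rho0|rho0] := eqVneq (rho (A *m q - p)) 0.
  have [s s0 se] : exists2 s, 0 <= s & s ^+ (m + n) = e.
    by apply: exists_root_ge0; [rewrite addn_gt0 hm | exact: ltW].
  have s1 : 0 < s.
    rewrite lt_neqAle s0 andbT eq_sym; apply/eqP => sE.
    by move: e0; rewrite -se sE expr0n addn_eq0 eqn0Ngt hm ltxx.
  (* The second bound is the time at which [e^(-t/n) sigma q] has decreased to [s]. *)
  exists (Num.max (T + 1) (- (n%:R * ln (s / sigma q)))).
    by rewrite lt_max ltrDl ltr01.
  set t := Num.max _ _.
  rewrite md rho0 expr0n eqn0Ngt hm mulr0 add0r -se lerXn2r ?nnegrE ?delta_ge0 //.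
  apply: (le_trans (delta_le t _ _ Zp Zq q0)).
  rewrite /height rho0 mulr0 ge_max s0 /= -ler_pdivlMr //.
  rewrite -[s / _]lnK ?posrE ?divr_gt0 // ler_expR ler_pdivrMr ?ltr0n // lerNl mulrC.
  by rewrite /t le_max lexx orbT.
have rho1 : 0 < rho (A *m q - p) by rewrite lt_neqAle eq_sym rho0 is_norm_ge0.
(* The minimizer [p] does at least as well as rounding [A q] coordinatewise, which leaves an error
   of sup norm at most 1. *)
have rhoC : rho (A *m q - p) <= C.
  have [p' Zp' pp'] := Zvec_near (A *m q).
  rewrite -(@ler_pXn2r _ m) ?nnegrE ?is_norm_ge0 // -md.
  apply: (le_trans (min_dist_le _ _ Zp')).
  rewrite lerXn2r ?nnegrE ?is_norm_ge0 //.
  by rewrite (le_trans (hC _)) // ler_piMr.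
(* The time at which both components of the vector have the same norm. *)
pose t := ln (sigma q / rho (A *m q - p)) / k.
have tE : expR (t / m%:R) * rho (A *m q - p) = expR (- t / n%:R) * sigma q.
  (* Multiplied by [e^(t/n)], the equation reads [e^(t k) rho (A q - p) = sigma q]. *)
  apply: (mulfI (lt0r_neq0 (expR_gt0 (t / n%:R)))).
  rewrite !mulrA -!expRD -mulrDl subrr mul0r expR0 mul1r addrC -mulrDr -/k.
  by rewrite /t divfK ?gt_eqF // lnK ?posrE ?divr_gt0 // divfK ?gt_eqF.
exists t.
  rewrite /t ltr_pdivlMr // -ltr_expR lnK ?posrE ?divr_gt0 // ltr_pdivlMr //.
  apply: lt_le_trans (hc q); rewrite mulrC [ltRHS]mulrC -ltr_pdivrMr //.
  by apply: le_lt_trans qM; rewrite ler_pM2r ?invr_gt0 // ler_pM2r ?expR_gt0.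
apply: (@le_trans _ _ (sigma q ^+ n * min_dist rho A q)); last by rewrite lerDl ltW.
apply: (@le_trans _ _ (height t p q ^+ (m + n))).
  rewrite lerXn2r ?nnegrE ?delta_ge0 ?delta_le //.
  by rewrite le_max mulr_ge0 // ?expR_ge0 // is_norm_ge0.
by rewrite md -(expR_mn t) /height -tE maxxx exprD.
Qed.

End dani_correspondence.

(** * Equality of the two lower limits *)

Theorem theorem1p2 (R : realType) (m n : nat) (hm : (0 < m)%N) (hn : (0 < n)%N)
    (A : 'M[R]_(m, n)) (rho : 'cV[R]_m -> R) (sigma : 'cV[R]_n -> R)
    (hrho : is_norm rho) (hsigma : is_norm sigma) :
  lagrange_constant rho sigma A =
  limf_einf
    (fun t : R =>
       (delta_norm (max_norm rho sigma) (lattice_act (gflow m n t) (xlat A)) ^+ (m + n))%:E)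
    (pinfty_nbhs R).
Proof.
have nonneg t :
    0 <= delta_norm (max_norm rho sigma) (lattice_act (gflow m n t) (xlat A)) ^+ (m + n).
  by rewrite exprn_ge0 //; exact: delta_ge0.
apply/le_anti/andP; split; apply: limf_einf_le => V.
- move=> [M _ hM].
  set I := ereal_inf _.
  have I_le q : Zvec R n q -> M < `|q| -> (I <= (sigma q ^+ n * min_dist rho A q)%:E)%E.
    by move=> Zq Mq; apply: ereal_inf_lbound; exists q => //; exact: hM.
  have [I0|I0] := leP I 0%E.
    exists setT; first exact: filterT.
    by move=> t _; rewrite (le_trans I0) // lee_fin.
  (* An integral vector beyond [M] shows that the infimum [I] is not infinite, hence a positive
     real. *)
  pose N := (Num.truncn `|M|).+1.
  have ZN : Zvec R n (const_mx N%:R).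
    by exists (const_mx N%:R) => //; apply/colP => i; rewrite !mxE rmorph_nat.
  have MN : M < `|const_mx N%:R : 'cV[R]_n|.
    apply: lt_le_trans (ler_mxnorm_entry _ (Ordinal hn)).
    by rewrite mxE normr_nat (le_lt_trans (ler_norm M)) // truncnS_gt.
  have := I_le _ ZN MN; move: I0 I_le; case: I => [r||] // r0 I_le _.
  have [T hT] := delta_ge_eventually A hm hn hrho hsigma r M r0 I_le.
  by exists [set t | T < t]; [apply: nbhs_pinfty_gt; exact: num_real|exact: hT].
(* For the converse, each far integral [q] has, for every [e], a time in the given neighbourhood of
   infinity whose value is within [e] above the term of [q] or lower. *)
- move=> [T [_ hT]].
  have [M hM] := delta_le_frequently A hm hn hrho hsigma T.
  exists [set q | Zvec R n q /\ M < `|q|]; first by exists M.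
  move=> q [Zq Mq]; apply/lee_addgt0Pr => e e0.
  have [t Tt ht] := hM q Zq Mq e e0.
  apply: ge_ereal_inf; eexists; first by exists t; [exact: hT|reflexivity].
  by rewrite -EFinD lee_fin.
Qed.
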